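(* Let $f=\frac1n\sum_{i=1}^n f_i:\mathbb{R}^d\to\mathbb{R}$ where each $f_i$ is (possibly nonconvex and) $L$-smooth, and suppose $f$ has a global minimizer $x^*$. Then the IFO complexity of the algorithm SAGA$(x^0,T,\eta)$ with $\eta=1/(3Ln^{2/3})$ to obtain an $\epsilon$-accurate solution is $O(n+n^{2/3}/\epsilon)$. That is, for every $\epsilon>0$ the number of iterations $T$ can be chosen such that the output $x_a$ satisfies $\mathbb{E}[\|\nabla f(x_a)\|^2]\le\epsilon$ and the total number of IFO calls is $O(n+n^{2/3}/\epsilon)$.
   Context: A differentiable function $h$ is $L$-smooth ($L>0$) if $\|\nabla h(x)-\nabla h(y)\|\le L\|x-y\|$ for all $x,y\in\mathbb{R}^d$. Write $[n]=\{1,\dots,n\}$. Algorithm SAGA$(x^0,T,\eta)$, with $x^0\in\mathbb{R}^d$, an integer $T\ge 1$ and step size $\eta>0$: set $\alpha_i^0=x^0$ for all $i\in[n]$ and $g^0=\frac1n\sum_{i=1}^n\nabla f_i(\alpha_i^0)$. For $t=0,\dots,T-1$: pick $i_t,j_t$ uniformly at random from $[n]$ (independently of each other and of the past); set $v^t=\nabla f_{i_t}(x^t)-\nabla f_{i_t}(\alpha_{i_t}^t)+g^t$; set $x^{t+1}=x^t-\eta v^t$; set $\alpha_{j_t}^{t+1}=x^t$ and $\alpha_j^{t+1}=\alpha_j^t$ for $j\ne j_t$; set $g^{t+1}=g^t-\frac1n(\nabla f_{j_t}(\alpha_{j_t}^t)-\nabla f_{j_t}(\alpha_{j_t}^{t+1}))$.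 Output $x_a$ chosen uniformly at random from $\{x^t\}_{t=0}^{T-1}$. Expectations are over all the randomness. An incremental first-order oracle (IFO) call takes $i\in[n]$ and $x\in\mathbb{R}^d$ and returns $(f_i(x),\nabla f_i(x))$. The gradients $\nabla f_i(\alpha_i^t)$ are kept in memory, so the algorithm uses $n$ IFO calls to initialize and $O(1)$ IFO calls per iteration. The IFO complexity is the number of IFO calls used. In $O(\cdot)$, the quantities $L$ and $f(x^0)-f(x^* )$ are treated as constants independent of $n$ and $\epsilon$ (the hidden constant may depend on them only). *)

(* Defs.v *)
From HB Require Import structures.
From mathcomp Require Import all_boot all_order all_algebra.
From mathcomp Require Import all_classical all_reals all_analysis.

Set Implicit Arguments.
Unset Strict Implicit.
Unset Printing Implicit Defensive.

Import Order.TTheory GRing.Theory Num.Theory.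
Import numFieldNormedType.Exports.

Local Open Scope classical_set_scope.
Local Open Scope ring_scope.

Section Functions.
Context {R : realType} {d : nat}.
Implicit Types (x y : 'rV[R]_d) (h : 'rV[R]_d -> R).

(* The library norm on ['rV[R]_d] is the sup norm; it induces the same
   topology, hence the same notion of differentiability. *)
Definition enorm x : R := Num.sqrt (\sum_k x ord0 k ^+ 2).

Definition gradient h x : 'rV[R]_d := \row_k 'D_(delta_mx ord0 k) h x.

Definition smooth (L : R) h : Prop :=
  (forall x, differentiable h x) /\
  (forall x y, enorm (gradient h x - gradient h y) <= L * enorm (x - y)).

Definition finite_mean (n : nat) (f : 'I_n -> 'rV[R]_d -> R) x : R :=
  n%:R^-1 * \sum_i f i x.

End Functions.

Section Oracle.
Context {R : realType} {n d : nat}.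

(* Programs whose only access to the functions [f i] is through incremental
   first-order oracle queries: [Query i x k] asks for the pair
   (f_i(x), grad f_i(x)) and continues with [k] applied to the answer. *)
Inductive ifo_prog (A : Type) : Type :=
| Ret of A
| Query of 'I_n & 'rV[R]_d & (R * 'rV[R]_d -> ifo_prog A).

Fixpoint bind (A B : Type) (p : ifo_prog A) (k : A -> ifo_prog B) : ifo_prog B :=
  match p with
  | Ret a => k a
  | Query i x c => Query i x (fun r => bind (c r) k)
  end.

Fixpoint result (A : Type) (f : 'I_n -> 'rV[R]_d -> R) (p : ifo_prog A) : A :=
  match p with
  | Ret a => a
  | Query i x c => result f (c (f i x, gradient (f i) x))
  end.

Fixpoint ifo_calls (A : Type) (f : 'I_n -> 'rV[R]_d -> R) (p : ifo_prog A) : nat :=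
  match p with
  | Ret _ => 0
  | Query i x c => (ifo_calls f (c (f i x, gradient (f i) x))).+1
  end.

End Oracle.

Arguments ifo_prog : clear implicits.

Section SAGA.
Context {R : realType} {n d : nat}.
Local Notation vec := 'rV[R]_d.
Local Notation prog := (ifo_prog R n d).

(* [alpha_grad s i] is the stored value of grad f_i (alpha s i); [alpha] itself
   is never read by the updates. *)
Record saga_state := SagaState {
  iterate : vec;
  alpha : 'I_n -> vec;
  alpha_grad : 'I_n -> vec;
  avg_grad : vec }.

Definition update (m : 'I_n -> vec) (j : 'I_n) (v : vec) : 'I_n -> vec :=
  fun k => if k == j then v else m k.

Fixpoint query_grads (x : vec) (s : seq 'I_n) (m : 'I_n -> vec) :
    prog ('I_n -> vec) :=
  match s with
  | [::] => Ret m
  | i :: s' => Query i x (fun r => query_grads x s' (update m i r.2))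
  end.

(* The memory starts with dummy values, all of which are overwritten by the
   [n] queries at [x0]. *)
Definition saga_init (x0 : vec) : prog saga_state :=
  bind (query_grads x0 (enum 'I_n) (fun=> 0)) (fun m =>
    Ret (SagaState x0 (fun=> x0) m (n%:R^-1 *: \sum_i m i))).

Definition saga_step (eta : R) (s : saga_state) (i j : 'I_n) : prog saga_state :=
  let x := iterate s in
  Query i x (fun ri => Query j x (fun rj =>
    let v := ri.2 - alpha_grad s i + avg_grad s in
    Ret (SagaState
      (x - eta *: v)
      (update (alpha s) j x)
      (update (alpha_grad s) j rj.2)
      (avg_grad s - n%:R^-1 *: (alpha_grad s j - rj.2))))).

(* Returns the iterates from which the successive steps are taken; the point
   reached by the last step is not included. *)
Fixpoint saga_iterates (eta : R) (s : saga_state) (ij : seq ('I_n * 'I_n)) :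
    prog (seq vec) :=
  match ij with
  | [::] => Ret [::]
  | (i, j) :: ij' =>
      bind (saga_step eta s i j) (fun s' =>
      bind (saga_iterates eta s' ij') (fun xs => Ret (iterate s :: xs)))
  end.

(* One run of SAGA for given values of the random choices: the indices
   [i t], [j t] for t < T and the index [a] of the returned iterate. *)
Definition saga (x0 : vec) (T : nat) (eta : R) (i j : 'I_T -> 'I_n) (a : 'I_T) :
    prog vec :=
  bind (saga_init x0) (fun s =>
  bind (saga_iterates eta s [seq (i t, j t) | t <- enum 'I_T]) (fun xs =>
  Ret (nth x0 xs a))).

End SAGA.

Section Randomness.
Context {dis : measure_display} {Omega : measurableType dis} {R : realType}.
Variable P : probability Omega R.

(* Independence of a finite family of classes of events. *)
Definition mutually_independent (I : finType) (G : I -> set (set Omega)) : Prop :=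
  forall (J : {set I}) (E : I -> set Omega), (forall k, k \in J -> G k (E k)) ->
    P (\bigcap_(k in [set` J]) E k) = (\prod_(k in J) P (E k))%E.

Definition uniform_rv (V : finType) (X : Omega -> V) : Prop :=
  (forall v, measurable (X @^-1` [set v])) /\
  (forall v, P (X @^-1` [set v]) = (#|V|%:R^-1)%:E).

Definition generated_events (V : finType) (X : Omega -> V) : set (set Omega) :=
  [set X @^-1` B | B in [set: set V]].

Record saga_randomness (n T : nat) (i j : 'I_T -> Omega -> 'I_n)
    (a : Omega -> 'I_T) : Prop := {
  uniform_i : forall t, uniform_rv (i t);
  uniform_j : forall t, uniform_rv (j t);
  uniform_a : uniform_rv a;
  independent_choices : mutually_independent (fun k : 'I_T + 'I_T + unit =>
        match k with
        | inl (inl t) => generated_events (i t)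
        | inl (inr t) => generated_events (j t)
        | inr _ => generated_events a
        end) }.

End Randomness.

(* Main.v *)
Require Import Defs.
From HB Require Import structures.
From mathcomp Require Import all_boot all_order all_algebra.
From mathcomp Require Import all_classical all_reals all_analysis.
From mathcomp Require Import measurable_realfun ring lra.

Import Order.TTheory GRing.Theory Num.Theory.
Import numFieldNormedType.Exports.

Local Open Scope classical_set_scope.
Local Open Scope ring_scope.

(* The Lyapunov function f(x) + c D, where D is the mean squared distance from x
   to the points alpha_k, decreases in expectation by (eta / 2) |grad f(x)|^2 at
   every step. The descent lemma controls f; the variance of the direction is at
   most L^2 D; and D contracts by 1 - 1/n because each step overwrites a
   uniformly chosen alpha_j with x, up to terms absorbed by Young's inequality
   with weight beta. With q = n^(1/3), eta = 1 / (3 L q^2) and beta = L / q, the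
   constant c = L / (10 q) is the same for all steps, so no backward recursion on
   c is needed. Since D = 0 initially, summing over T steps bounds the mean of
   |grad f(x^t)|^2 by 6 L q^2 (f(x0) - f(xstar)) / T, while a run makes n + 2 T
   oracle calls. Expectations are sums over the finitely many equiprobable values
   of the random choices. *)

(** * Euclidean inner product and Young's inequality *)

Section DotProduct.
Context {R : realType} {d : nat}.
Implicit Types (u v w : 'rV[R]_d) (a : R).

Definition dot u v : R := \sum_k u ord0 k * v ord0 k.

Lemma dotC u v : dot u v = dot v u.
Proof. by apply: eq_bigr => k _; rewrite mulrC. Qed.

Lemma dotDl u v w : dot (u + v) w = dot u w + dot v w.
Proof. by rewrite -big_split; apply: eq_bigr => k _; rewrite mxE mulrDl. Qed.

Lemma dotZl a u v : dot (a *: u) v = a * dot u v.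
Proof. by rewrite mulr_sumr; apply: eq_bigr => k _; rewrite mxE mulrA. Qed.

Lemma dotNl u v : dot (- u) v = - dot u v.
Proof. by rewrite -scaleN1r dotZl mulN1r. Qed.

Lemma dotBl u v w : dot (u - v) w = dot u w - dot v w.
Proof. by rewrite dotDl dotNl. Qed.

Lemma dotDr u v w : dot w (u + v) = dot w u + dot w v.
Proof. by rewrite !(dotC w) dotDl. Qed.

Lemma dotZr a u v : dot v (a *: u) = a * dot v u.
Proof. by rewrite !(dotC v) dotZl. Qed.

Lemma dotNr u v : dot v (- u) = - dot v u.
Proof. by rewrite !(dotC v) dotNl. Qed.

Lemma dotBr u v w : dot w (u - v) = dot w u - dot w v.
Proof. by rewrite !(dotC w) dotBl. Qed.

Lemma dot_sqrD u v : dot (u + v) (u + v) = dot u u + 2 * dot u v + dot v v.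
Proof. by rewrite !(dotDl, dotDr) (dotC v u); ring. Qed.

Lemma dot_sqrB u v : dot (u - v) (u - v) = dot u u - 2 * dot u v + dot v v.
Proof. by rewrite dot_sqrD !(dotNr, dotNl) opprK mulrN. Qed.

Lemma dot_suml (I : finType) (F : I -> 'rV[R]_d) v :
  dot (\sum_i F i) v = \sum_i dot (F i) v.
Proof.
rewrite exchange_big; apply: eq_bigr => k _.
by rewrite summxE mulr_suml.
Qed.

Lemma dotvv_ge0 u : 0 <= dot u u.
Proof. by apply: sumr_ge0 => k _; rewrite -expr2 sqr_ge0. Qed.

Lemma enorm_ge0 u : 0 <= enorm u.
Proof. exact: sqrtr_ge0. Qed.

Lemma enorm_sqr u : enorm u ^+ 2 = dot u u.
Proof.
rewrite sqr_sqrtr; last by apply: sumr_ge0 => k _; rewrite sqr_ge0.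
by apply: eq_bigr => k _; rewrite expr2.
Qed.

(** This is [|b u - v|^2 >= 0], expanded and divided by [b]. *)
Lemma dot_young (b : R) u v : 0 < b ->
  2 * dot u v <= b * dot u u + b^-1 * dot v v.
Proof.
move=> b0; rewrite -(ler_pM2l b0).
have -> : b * (b * dot u u + b^-1 * dot v v) = b * b * dot u u + dot v v.
  by field; rewrite gt_eqF.
have := dotvv_ge0 (b *: u - v).
rewrite !(dotBl, dotBr, dotZl, dotZr) (dotC v u); lra.
Qed.

(** Young's inequality with weight [a^-1] takes the place of Cauchy-Schwarz: both terms on its right
    are then at most [a |v|^2]. *)
Lemma dot_le_of_enorm_le a u v : 0 < a -> enorm u <= a * enorm v ->
  dot u v <= a * dot v v.
Proof.
move=> a0 uv; have := @dot_young a^-1 u v; rewrite invr_gt0 => /(_ a0).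
have uu : dot u u <= a ^+ 2 * dot v v.
  rewrite -!enorm_sqr -exprMn ler_sqr ?nnegrE ?enorm_ge0//.
  by rewrite mulr_ge0 ?enorm_ge0 ?ltW.
have : a^-1 * dot u u <= a * dot v v.
  by rewrite mulrC ler_pdivrMr// mulrAC -expr2.
by rewrite invrK; lra.
Qed.

End DotProduct.

(** * Gradients and the descent lemma for smooth functions *)

Section Smooth.
Context {R : realType} {d : nat}.
Implicit Types (x y z : 'rV[R]_d) (h : 'rV[R]_d -> R).

Lemma derive_gradient h x y : differentiable h x ->
  'D_y h x = dot (gradient h x) y.
Proof.
move=> dh; rewrite deriveE// {1}[y]row_sum_delta linear_sum/=.
apply: eq_bigr => k _.
by rewrite linearZ/= -deriveE// mxE mulrC.
Qed.

(** The difference quotients of the restriction at [t] are literally those of [h] at [x + t y] in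
    direction [y]. *)
Lemma derive_along_line h x y (t : R) : differentiable h (x + t *: y) ->
  is_derive t 1 (fun s : R => h (x + s *: y)) (dot (gradient h (x + t *: y)) y).
Proof.
move=> dh.
have E : (fun s : R => s^-1 *: (((fun s : R => h (x + s *: y)) \o shift t) (s *: (1 : R)) -
    h (x + t *: y))) =
  (fun s : R => s^-1 *: ((h \o shift (x + t *: y)) (s *: y) - h (x + t *: y))).
  apply/funext => s /=; congr (_ *: (h _ - _)).
  by rewrite [s *: 1]mulr1 scalerDl addrCA.
have D : derivable h (x + t *: y) y by exact: diff_derivable.
split; first by move: D; rewrite /derivable E.
by rewrite -derive_gradient// /derive E.
Qed.

Lemma descent (L : R) h x y : 0 < L -> smooth L h ->
  h y <= h x + dot (gradient h x) (y - x) + L / 2 * dot (y - x) (y - x).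
Proof.
move=> L0 [dh Lh]; set z := y - x.
pose p (t : R) := h (x + t *: z).
(* [q] is [h] along the segment minus its quadratic upper model; the claim is [q 1 <= q 0], so it is
   enough that [q] has derivative at most 0 on the open interval. *)
pose q (t : R) := p t - (t * dot (gradient h x) z + L / 2 * dot z z * t ^+ 2).
have dq (t : R) : is_derive t 1 q
   (dot (gradient h (x + t *: z)) z - (dot (gradient h x) z + L * dot z z * t)).
  have dp : is_derive t 1 p _ := derive_along_line h x z t (dh _).
  apply: is_derive_eq.
  rewrite /GRing.scale/=; lra.
have : q 1 <= q 0.
  apply: (@ler0_derive1_le_cc R q 0 1); rewrite ?in_itv/= ?lexx ?ler01//.
  - move=> t; rewrite in_itv/= => /andP[t0 _].
    rewrite derive1E derive_val.
    (* Between [x] and [x + t z] the gradient moves by at most [L t |z|], which the derivative of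
       the quadratic term compensates. *)
    have zt : enorm (gradient h (x + t *: z) - gradient h x)
        <= (L * t) * enorm z.
      apply: (le_trans (Lh _ _)); rewrite addrAC subrr add0r -mulrA ler_pM2l//.
      suff -> : enorm (t *: z) = t * enorm z by [].
      apply/eqP; rewrite -(@eqrXn2 _ 2) ?enorm_ge0 ?mulr_ge0 ?enorm_ge0 ?ltW//.
      by rewrite exprMn !enorm_sqr dotZl dotZr mulrA expr2.
    have := dot_le_of_enorm_le _ _ _ (mulr_gt0 L0 t0) zt.
    rewrite dotBl; lra.
  - apply: derivable_within_continuous => t _; exact: ex_derive.
rewrite /q /p scale1r scale0r addr0 /z (addrC x) subrK; lra.
Qed.

Lemma gradient_finite_mean (n : nat) (f : 'I_n -> 'rV[R]_d -> R) x :
  (forall i, differentiable (f i) x) ->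
  gradient (finite_mean f) x = n%:R^-1 *: \sum_i gradient (f i) x.
Proof.
move=> df; apply/rowP => k; rewrite !mxE summxE.
have -> : finite_mean f = n%:R^-1 \*: (\sum_i f i).
  by apply/funext => y; rewrite /finite_mean /= fct_sumE.
have D i : derivable (f i) x (delta_mx ord0 k) by exact: diff_derivable.
rewrite deriveZ ?derive_sum//; last exact: derivable_sum.
by congr (_ * _); apply: eq_bigr => i _; rewrite mxE.
Qed.

End Smooth.

(** * Descent for the mean, and sums over an overwritten memory *)

Lemma sumr_const_ord {R : pzRingType} (n : nat) (a : R) :
  \sum_(i < n) a = n%:R * a.
Proof. by rewrite sumr_const card_ord mulr_natl. Qed.

(** The descent inequalities of the single [f i] are averaged, which bypasses the smoothness of the
    mean. *)
Lemma finite_mean_descent {R : realType} {n d : nat} (L : R)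
    (f : 'I_n -> 'rV[R]_d -> R) (x y : 'rV[R]_d) :
  (0 < n)%N -> 0 < L -> (forall i, smooth L (f i)) ->
  finite_mean f y <= finite_mean f x + dot (gradient (finite_mean f) x) (y - x)
    + L / 2 * dot (y - x) (y - x).
Proof.
move=> n0 L0 Lf; have N0 : 0 < n%:R :> R by rewrite ltr0n.
rewrite gradient_finite_mean; last by move=> i; case: (Lf i).
rewrite dotZl dot_suml -(ler_pM2l N0) !mulrDr /finite_mean.
rewrite !(mulrA n%:R n%:R^-1) divff ?gt_eqF// !mul1r.
rewrite -[n%:R * _]sumr_const_ord -!big_split/=.
by apply: ler_sum => i _; exact: descent.
Qed.

(** The slot [k] is fixed and the overwritten index [j] varies: one choice of [j] stores [v] in it,
    the other [n - 1] leave [m k]. This is the source of the contraction by [1 - 1/n]. *)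
Lemma sum_update {R : realType} {n d : nat} {V : zmodType} (g : 'rV[R]_d -> V)
    (m : 'I_n -> 'rV[R]_d) (v : 'rV[R]_d) (k : 'I_n) :
  \sum_j g (update m j v k) = g v + g (m k) *+ n.-1.
Proof.
rewrite (bigD1 k)//= /update eqxx; congr (_ + _).
rewrite (eq_bigr (fun=> g (m k))); last first.
  by move=> j jk; rewrite eq_sym (negbTE jk).
by rewrite sumr_const cardC1 card_ord.
Qed.

(** Here the overwritten index is fixed and the slot varies; this keeps [avg_grad] equal to the mean
    of the stored gradients. *)
Lemma sum_updated {R : realType} {n d : nat}
    (m : 'I_n -> 'rV[R]_d) (v : 'rV[R]_d) (j : 'I_n) :
  \sum_k update m j v k = \sum_k m k - m j + v.
Proof.
rewrite (bigD1 j)//= [in RHS](bigD1 j)//= /update eqxx [m j + _]addrC addrK addrC.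
by congr (_ + _); apply: eq_bigr => k /negbTE ->.
Qed.

(** * Expected change of the Lyapunov function in one step *)

Section OneStep.
Context {R : realType} {n d : nat}.
Variables (f : 'I_n -> 'rV[R]_d -> R) (eta : R).
Implicit Types s : @saga_state R n d.

(** The updates never read [alpha], so its relation to the stored gradients is carried along as an
    invariant. *)
Definition consistent s : Prop :=
  (forall k, alpha_grad s k = gradient (f k) (alpha s k)) /\
  avg_grad s = n%:R^-1 *: \sum_k alpha_grad s k.

Definition direction s (i : 'I_n) : 'rV[R]_d :=
  gradient (f i) (iterate s) - alpha_grad s i + avg_grad s.

Definition next_state s (i j : 'I_n) := result f (saga_step eta s i j).

Definition memory_sqdist s : R :=
  \sum_k dot (iterate s - alpha s k) (iterate s - alpha s k).

Definition lyapunov (c : R) s : R :=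
  finite_mean f (iterate s) + c * (n%:R^-1 * memory_sqdist s).

Lemma consistent_next_state s i j : consistent s -> consistent (next_state s i j).
Proof.
move=> [ag av]; split=> [k|] /=; first by rewrite /update; case: eqP => [->|].
by rewrite sum_updated av -scalerBr opprB -addrA [- _ + _]addrC.
Qed.

Hypothesis n_gt0 : (0 < n)%N.
Variable L : R.
Hypothesis L_gt0 : 0 < L.
Hypothesis f_smooth : forall i, smooth L (f i).

Let N_gt0 : 0 < n%:R :> R. Proof. by rewrite ltr0n. Qed.
Let N_neq0 : n%:R != 0 :> R. Proof. by rewrite gt_eqF. Qed.

Let G s := gradient (finite_mean f) (iterate s).

(** The direction is unbiased: on average over [i], the subtracted stored gradients cancel
    [avg_grad]. *)
Lemma sum_direction s : consistent s ->
  \sum_i direction s i = n%:R *: G s.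
Proof.
move=> [_ av]; rewrite /G gradient_finite_mean; last by move=> i; case: (f_smooth i).
rewrite !big_split/= sumr_const card_ord av -scaler_nat !scalerA divff// !scale1r.
by rewrite sumrN subrK.
Qed.

(* The directions have mean [G s], so their variance is at most the second
   moment of [gradient (f i) (iterate s) - alpha_grad s i]. *)
Lemma sum_direction_sqr s : consistent s ->
  \sum_i dot (direction s i) (direction s i) <=
    L ^+ 2 * memory_sqdist s + n%:R * dot (G s) (G s).
Proof.
move=> cs; have sV := sum_direction s cs; case: cs => ag av.
pose D i := gradient (f i) (iterate s) - alpha_grad s i.
have sD : \sum_i D i = n%:R *: (G s - avg_grad s).
  rewrite scalerBr -sV [in RHS]big_split/= sumr_const card_ord -scaler_nat.
  by rewrite addrK.
have -> : \sum_i dot (direction s i) (direction s i) =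
    \sum_i dot (D i) (D i) + 2 * dot (\sum_i D i) (avg_grad s)
    + n%:R * dot (avg_grad s) (avg_grad s).
  rewrite dot_suml mulr_sumr -[n%:R * _]sumr_const_ord -!big_split/=.
  apply: eq_bigr => i _; exact: dot_sqrD.
have DL : \sum_i dot (D i) (D i) <= L ^+ 2 * memory_sqdist s.
  rewrite mulr_sumr; apply: ler_sum => i _.
  rewrite -!enorm_sqr -exprMn ler_sqr ?nnegrE ?enorm_ge0//; last first.
    by rewrite mulr_ge0 ?enorm_ge0 ?ltW.
  by rewrite /D ag; case: (f_smooth i) => _; exact.
(* Completing the square turns the last two terms into [n |G s|^2 - n |G s - avg_grad s|^2], and the
   negative part is dropped. *)
have := dotvv_ge0 (G s - avg_grad s).
rewrite sD dotZl !(dotBl, dotBr) (dotC (avg_grad s)) => GA.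
have := mulr_ge0 (ltW N_gt0) GA.
lra.
Qed.

(** The next iterate does not depend on [j], hence the outer factor [n]; in the sum over [i] the
    linear terms of the descent inequality add up to [n |G s|^2] by unbiasedness. *)
Lemma sum_finite_mean_next s : consistent s ->
  \sum_i \sum_j finite_mean f (iterate (next_state s i j)) <=
    n%:R * (n%:R * (finite_mean f (iterate s) - eta * dot (G s) (G s))
      + L / 2 * eta ^+ 2 * \sum_i dot (direction s i) (direction s i)).
Proof.
move=> cs; have sV := sum_direction s cs.
have -> : n%:R * (finite_mean f (iterate s) - eta * dot (G s) (G s)) =
    \sum_(i < n) finite_mean f (iterate s)
    - eta * \sum_i dot (direction s i) (G s).
  by rewrite -dot_suml sV dotZl sumr_const_ord; ring.
have -> : \sum_i \sum_j finite_mean f (iterate (next_state s i j)) =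
    \sum_i n%:R * finite_mean f (iterate s - eta *: direction s i).
  by apply: eq_bigr => i _; rewrite -sumr_const_ord.
rewrite !mulr_sumr -sumrB -big_split mulr_sumr; apply: ler_sum => i _.
rewrite ler_pM2l//.
apply: (le_trans (finite_mean_descent L f (iterate s) _ n_gt0 L_gt0 f_smooth)).
rewrite -/(G s).
have -> : iterate s - eta *: direction s i - iterate s = - (eta *: direction s i).
  by rewrite addrAC subrr add0r.
rewrite !(dotNl, dotNr, dotZl, dotZr) (dotC (G s)) /=; lra.
Qed.

(** For each slot [k], the choice [j = k] leaves the distance [eta |v|] from the new iterate to the
    old one, with [v] the direction; for the other [n - 1] choices the square is expanded, and its
    cross term has mean direction [G s]. *)
Lemma sum_memory_sqdist_next (beta : R) s : 0 < eta -> 0 < beta -> consistent s ->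
  \sum_i \sum_j memory_sqdist (next_state s i j) <=
    n%:R ^+ 2 * eta ^+ 2 * \sum_i dot (direction s i) (direction s i)
    + (n%:R - 1) * n%:R * ((1 + eta * beta) * memory_sqdist s
        + n%:R * (eta / beta) * dot (G s) (G s)).
Proof.
move=> eta0 beta0 cs; have sV := sum_direction s cs.
set S := \sum_i dot _ _.
have -> : \sum_i \sum_j memory_sqdist (next_state s i j) =
    \sum_k (eta ^+ 2 * S + (n%:R - 1) *
      (n%:R * dot (iterate s - alpha s k) (iterate s - alpha s k)
       - 2 * eta * n%:R * dot (G s) (iterate s - alpha s k) + eta ^+ 2 * S)).
  under eq_bigr do rewrite exchange_big/=.
  rewrite exchange_big/=; apply: eq_bigr => k _.
  pose g i := iterate s - eta *: direction s i.
  under eq_bigr => i _ do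
    rewrite (sum_update (fun v => dot (g i - v) (g i - v)) (alpha s))
      -mulr_natl -subn1 natrB//.
  rewrite big_split/= -mulr_sumr; congr (_ + _ * _).
    rewrite mulr_sumr; apply: eq_bigr => i _.
    by rewrite /g addrAC subrr add0r dotNl dotNr opprK dotZl dotZr mulrA expr2.
  rewrite -[2 * eta * n%:R * _]mulrA -[n%:R * dot (G s) _]dotZl -sV dot_suml.
  rewrite [2 * eta * _]mulr_sumr [eta ^+ 2 * S]mulr_sumr.
  rewrite -[n%:R * _]sumr_const_ord -sumrB -big_split/=.
  apply: eq_bigr => i _; rewrite /g [in LHS](addrAC (iterate s)) [in LHS]dot_sqrB.
  by rewrite !(dotZl, dotZr) (dotC _ (direction s i)); ring.
have N1 : 0 <= n%:R - 1 :> R by rewrite subr_ge0 ler1n.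
pose K := eta ^+ 2 * S + (n%:R - 1) * (n%:R * (eta / beta) * dot (G s) (G s) + eta ^+ 2 * S).
pose M := (n%:R - 1) * (n%:R * (1 + eta * beta)).
apply: (@le_trans _ _ (\sum_(k < n)
    (K + M * dot (iterate s - alpha s k) (iterate s - alpha s k)))).
  apply: ler_sum => k _; rewrite /K /M.
  have b0 : 0 < beta^-1 by rewrite invr_gt0.
  (* The cross term is split so that the distance gets weight [eta beta] and the gradient
     [eta / beta]. *)
  have := @dot_young _ _ beta^-1 (- G s) (iterate s - alpha s k) b0.
  rewrite dotNl dotNr dotNl opprK invrK => Y.
  have := ler_wpM2l (mulr_ge0 N1 (ltW (mulr_gt0 eta0 N_gt0))) Y.
  lra.
rewrite big_split/= sumr_const_ord -[\sum_i M * _]mulr_sumr -/(memory_sqdist s).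
by rewrite le_eqVlt /K /M; apply/orP; left; apply/eqP; ring.
Qed.

(** The two numeric conditions collect coefficients once the second moment of the direction is
    bounded: the first keeps that of the mean squared distance at most [c], the second leaves half
    of the decrease [eta |G s|^2]. *)
Lemma lyapunov_step (beta c : R) s : 0 < eta -> 0 < beta -> 0 <= c ->
  L ^+ 3 * eta ^+ 2 / 2 + c * (eta * L) ^+ 2 + c * (1 - n%:R^-1) * (1 + eta * beta)
    <= c ->
  L * eta ^+ 2 / 2 + c * eta ^+ 2 + c * (1 - n%:R^-1) * (eta / beta)
    <= eta / 2 ->
  consistent s ->
  \sum_i \sum_j lyapunov c (next_state s i j) +
    n%:R ^+ 2 * (eta / 2 * dot (G s) (G s)) <= n%:R ^+ 2 * lyapunov c s.
Proof.
move=> eta0 beta0 c0 Hc Hg cs.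
have Hf := sum_finite_mean_next s cs.
have Hd := sum_memory_sqdist_next beta s eta0 beta0 cs.
have HS := sum_direction_sqr s cs.
have -> : \sum_i \sum_j lyapunov c (next_state s i j) =
    \sum_i \sum_j finite_mean f (iterate (next_state s i j)) +
    c * (n%:R^-1 * \sum_i \sum_j memory_sqdist (next_state s i j)).
  rewrite !mulr_sumr -big_split/=; apply: eq_bigr => i _.
  by rewrite !mulr_sumr -big_split.
rewrite /lyapunov.
move: Hf Hd HS.
set A := \sum_i \sum_j finite_mean _ _.
set B := \sum_i \sum_j memory_sqdist _.
set S := \sum_i dot _ _.
set F := finite_mean _ _; set E := memory_sqdist s.
have E0 : 0 <= E by apply: sumr_ge0 => k _; exact: dotvv_ge0.
have := dotvv_ge0 (G s).
set g := dot _ _.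
set N : R := n%:R => g0 Hf Hd HS.
have cN : 0 <= c * N^-1 by rewrite mulr_ge0// invr_ge0 ltW.
have := ler_wpM2l cN Hd.
(* This is the total weight of [S] in the bounds for [A] and for [c / N] times [B]. *)
have w0 : 0 <= N * (L / 2 * eta ^+ 2 + c * eta ^+ 2).
  rewrite mulr_ge0 ?addr_ge0 ?(ltW N_gt0)//; last by rewrite mulr_ge0 ?sqr_ge0.
  by rewrite mulr_ge0 ?sqr_ge0 ?divr_ge0 ?(ltW L_gt0).
have := ler_wpM2l w0 HS.
have := ler_wpM2l (mulr_ge0 (ltW N_gt0) E0) Hc.
have := ler_wpM2l (mulr_ge0 (exprn_ge0 2 (ltW N_gt0)) g0) Hg.
move=> K1 K2 K3 K4.
have -> : c * (N^-1 * B) = c * N^-1 * B by ring.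
have -> : N ^+ 2 * (F + c * (N^-1 * E)) = N ^+ 2 * F + c * N * E by rewrite /N; field.
have K5 : c * N^-1 * (N ^+ 2 * eta ^+ 2 * S + (N - 1) * N *
     ((1 + eta * beta) * E + N * (eta / beta) * g)) =
   c * N * eta ^+ 2 * S + c * (N - 1) * (1 + eta * beta) * E
     + c * (N - 1) * N * (eta / beta) * g by rewrite /N; field; rewrite N_neq0 gt_eqF.
have {}K2 : N * E * (L ^+ 3 * eta ^+ 2 / 2 + c * (eta * L) ^+ 2)
    + c * (N - 1) * (1 + eta * beta) * E <= N * E * c.
  by apply: le_trans K2; rewrite le_eqVlt; apply/orP; left; apply/eqP; rewrite /N; field.
have {}K1 : N ^+ 2 * g * (L * eta ^+ 2 / 2 + c * eta ^+ 2)
    + c * (N - 1) * N * (eta / beta) * g <= N ^+ 2 * g * (eta / 2).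
  apply: le_trans K1; rewrite le_eqVlt; apply/orP; left; apply/eqP.
  by rewrite /N; field; rewrite N_neq0 gt_eqF.
rewrite K5 in K4.
lra.
Qed.

End OneStep.

(** * Results and oracle counts of composed programs *)

Section Programs.
Context {R : realType} {n d : nat} {A B : Type}.
Variable f : 'I_n -> 'rV[R]_d -> R.

Lemma result_bind (p : ifo_prog R n d A) (k : A -> ifo_prog R n d B) :
  result f (bind p k) = result f (k (result f p)).
Proof. by elim: p => //= i x c IH; rewrite IH. Qed.

Lemma ifo_calls_bind (p : ifo_prog R n d A) (k : A -> ifo_prog R n d B) :
  ifo_calls f (bind p k) = (ifo_calls f p + ifo_calls f (k (result f p)))%N.
Proof. by elim: p => //= i x c IH; rewrite IH addSn. Qed.

End Programs.

Lemma sum_tuple_cons {V : nmodType} {I : finType} (T : nat) (F : seq I -> V) :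
  \sum_(w : T.+1.-tuple I) F w = \sum_p \sum_(w : T.-tuple I) F (p :: w).
Proof.
rewrite pair_bigA/=.
rewrite (reindex (fun q : I * T.-tuple I => [tuple of q.1 :: q.2]))//=.
exists (fun w : T.+1.-tuple I => (thead w, [tuple of behead w])).
  by move=> [p w] _ /=; congr (_, _); apply: val_inj.
by move=> w _; rewrite [RHS]tuple_eta.
Qed.

(** * Whole runs, summed over all choices *)

Section Runs.
Context {R : realType} {n d : nat}.
Variables (f : 'I_n -> 'rV[R]_d -> R) (eta : R).
Implicit Types (s : @saga_state R n d) (ij : seq ('I_n * 'I_n)).

Lemma result_query_grads (x : 'rV[R]_d) (ks : seq 'I_n) m k :
  result f (query_grads x ks m) k =
  if k \in ks then gradient (f k) x else m k.
Proof.
elim: ks m => //= l ks IH m; rewrite IH in_cons /update.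
by case: eqP => [->|]; case: ifP.
Qed.

Lemma ifo_calls_query_grads (x : 'rV[R]_d) (ks : seq 'I_n) m :
  ifo_calls f (query_grads x ks m) = size ks.
Proof. by elim: ks m => //= l ks IH m; rewrite IH. Qed.

Lemma result_saga_iterates_cons s p ij :
  result f (saga_iterates eta s (p :: ij)) =
  iterate s :: result f (saga_iterates eta (next_state f eta s p.1 p.2) ij).
Proof. by case: p => i j /=; rewrite result_bind. Qed.

Lemma size_saga_iterates s ij :
  size (result f (saga_iterates eta s ij)) = size ij.
Proof.
elim: ij s => // p ij IH s.
by rewrite result_saga_iterates_cons /= IH.
Qed.

Lemma ifo_calls_saga_iterates s ij :
  ifo_calls f (saga_iterates eta s ij) = (size ij).*2.
Proof.
elim: ij s => // -[i j] ij IH s.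
by rewrite /= ifo_calls_bind /= IH addn0 doubleS.
Qed.

Lemma ifo_calls_saga (x0 : 'rV[R]_d) (T : nat) (i j : 'I_T -> 'I_n) (a : 'I_T) :
  ifo_calls f (saga x0 eta i j a) = (n + T.*2)%N.
Proof.
rewrite !ifo_calls_bind /= ifo_calls_query_grads ifo_calls_saga_iterates.
by rewrite size_map !size_enum_ord !addn0.
Qed.

Let initial_state (x0 : 'rV[R]_d) := result f (saga_init x0).

Lemma consistent_initial_state x0 : consistent f (initial_state x0).
Proof.
rewrite /initial_state /saga_init result_bind; split => //= k.
by rewrite result_query_grads mem_enum.
Qed.

Lemma lyapunov_initial_state (c : R) x0 :
  lyapunov f c (initial_state x0) = finite_mean f x0.
Proof.
rewrite /initial_state /saga_init result_bind /lyapunov /memory_sqdist /=.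
rewrite big1 ?mulr0 ?addr0// => k _.
by rewrite subrr -[0](scale0r 0) dotZl mul0r.
Qed.

Variables (c : R) (gap : 'rV[R]_d -> R) (fmin : R).
Hypothesis c_ge0 : 0 <= c.
Hypothesis fmin_le : forall x, fmin <= finite_mean f x.
Hypothesis step : forall s, consistent f s ->
  \sum_i \sum_j lyapunov f c (next_state f eta s i j) + n%:R ^+ 2 * gap (iterate s)
    <= n%:R ^+ 2 * lyapunov f c s.

(** The one-step inequality telescopes by induction on [T] with [s] general; [(n^2)^T] counts the
    sequences of index pairs. At the end the Lyapunov value is at least [fmin], its distance term
    being nonnegative. *)
Lemma sum_gap_iterates (T : nat) s : consistent f s ->
  \sum_(w : T.-tuple ('I_n * 'I_n)) \sum_(x <- result f (saga_iterates eta s w)) gap x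
    <= (n%:R ^+ 2) ^+ T * (lyapunov f c s - fmin).
Proof.
elim: T s => [|T IH] s cs.
  rewrite big1 => [|w _]; last by rewrite tuple0 /= big_nil.
  rewrite expr0 mul1r subr_ge0 (le_trans (fmin_le (iterate s)))// lerDl mulr_ge0//.
  by rewrite mulr_ge0 ?invr_ge0 ?ler0n// sumr_ge0// => k _; exact: dotvv_ge0.
rewrite (sum_tuple_cons T (fun w => \sum_(x <- result f (saga_iterates eta s w)) gap x)).
have sum_w (b : R) : \sum_(w : T.-tuple ('I_n * 'I_n)) b = (n%:R ^+ 2) ^+ T * b.
  by rewrite sumr_const card_tuple card_prod card_ord -[b *+ _]mulr_natl natrX natrM expr2.
have sum_p (b : R) : \sum_(p : 'I_n * 'I_n) b = n%:R ^+ 2 * b.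
  by rewrite sumr_const card_prod card_ord -[b *+ _]mulr_natl natrM expr2.
apply: (@le_trans _ _ (\sum_(p : 'I_n * 'I_n) (n%:R ^+ 2) ^+ T *
   (gap (iterate s) + (lyapunov f c (next_state f eta s p.1 p.2) - fmin)))).
  apply: ler_sum => p _.
  rewrite (eq_bigr (fun w : T.-tuple _ => gap (iterate s) + \sum_(x <- result f
    (saga_iterates eta (next_state f eta s p.1 p.2) w)) gap x)); last first.
    by move=> w _; rewrite result_saga_iterates_cons big_cons.
  rewrite big_split/= sum_w mulrDr lerD2l.
  by apply: IH; exact: consistent_next_state.
rewrite -mulr_sumr (exprS _ T) [_ ^+ 2 * _]mulrC -mulrA ler_wpM2l ?exprn_ge0 ?ler0n//.
have := step s cs; rewrite pair_bigA/= => st.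
rewrite big_split/= sumrB !sum_p.
lra.
Qed.

(** Summing over the output index [a] runs through the list of iterates exactly once, as that list
    has length [T]; the default of [nth] is never returned. *)
Lemma sum_gap_saga (T : nat) (x0 : 'rV[R]_d) :
  \sum_(q : T.-tuple ('I_n * 'I_n) * 'I_T)
    gap (result f (saga x0 eta (fun t => (tnth q.1 t).1) (fun t => (tnth q.1 t).2) q.2))
  <= (n%:R ^+ 2) ^+ T * (finite_mean f x0 - fmin).
Proof.
have := sum_gap_iterates T _ (consistent_initial_state x0).
rewrite lyapunov_initial_state; apply: le_trans.
rewrite -(pair_bigA _ (fun (w : T.-tuple _) a =>
  gap (result f (saga x0 eta (fun t => (tnth w t).1) (fun t => (tnth w t).2) a))))/=.
rewrite le_eqVlt; apply/orP; left; apply/eqP; apply: eq_bigr => w _.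
rewrite (big_nth x0) size_saga_iterates size_tuple big_mkord.
apply: eq_bigr => a _; congr gap.
have wE : [seq ((tnth w t).1, (tnth w t).2) | t <- enum 'I_T] = w.
  by rewrite -[RHS]map_tnth_enum; apply: eq_map => t; case: (tnth w t).
rewrite /saga /= wE (result_bind _ (saga_init x0)).
by rewrite (result_bind _ (saga_iterates _ _ _)).
Qed.

End Runs.

(** * From expectations to finite sums *)

Section Expectation.
Context {dis : measure_display} {Omega : measurableType dis} {R : realType}.
Variable P : probability Omega R.

(** [F (X w)] is a finite sum of indicators with nonnegative weights, which is integrated term by
    term. *)
Lemma expectation_equiprobable (V : finType) (X : Omega -> V) (F : V -> R) (p : R) :
  (forall v, 0 <= F v) -> (forall v, measurable (X @^-1` [set v])) ->
  (forall v, P (X @^-1` [set v]) = p%:E) ->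
  ('E_P[fun w => F (X w)] = (p * \sum_v F v)%:E)%E.
Proof.
move=> F0 mX PX; rewrite unlock.
under eq_integral => w _.
  rewrite (_ : (F (X w))%:E = \sum_v ((F v)%:E * (\1_(X @^-1` [set v]) w)%:E)%E); last first.
    rewrite (bigD1 (X w))//= big1 => [|v vX]; rewrite indicE.
      by rewrite mem_set//= mule1 adde0.
    by rewrite memNset ?mule0// => /= /esym/eqP; rewrite (negbTE vX).
  over.
have mI v : measurable_fun [set: Omega] (EFin \o (\1_(X @^-1` [set v]) : Omega -> R)).
  by apply/measurable_EFinP; exact: measurable_indic.
rewrite ge0_integral_sum//; first last.
- by move=> v w _; rewrite mule_ge0// lee_fin.
- move=> v. by apply: measurable_funeM; exact: mI.
rewrite mulr_sumr -sumEFin; apply: eq_bigr => v _.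
rewrite ge0_integralZl_EFin//; last exact: mI.
rewrite integral_indic// setIT mulrC EFinM; congr (_ * _)%E; exact: PX.
Qed.

(** Prescribing all choices is an intersection of one event per variable; independence over the full
    index set gives [2 T] factors [1/n] and one [1/T]. *)
Lemma probability_choices (n T : nat) (i j : 'I_T -> Omega -> 'I_n) (a : Omega -> 'I_T)
    (u : T.-tuple ('I_n * 'I_n) * 'I_T) :
  saga_randomness P i j a ->
  let X w := ([tuple (i t w, j t w) | t < T], a w) in
  measurable (X @^-1` [set u]) /\
  P (X @^-1` [set u]) = (((n%:R ^+ 2) ^+ T)^-1 * T%:R^-1)%:E.
Proof.
case=> ui uj ua ind X.
pose E (k : 'I_T + 'I_T + unit) := match k with
  | inl (inl t) => i t @^-1` [set (tnth u.1 t).1]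
  | inl (inr t) => j t @^-1` [set (tnth u.1 t).2]
  | inr _ => a @^-1` [set u.2]
  end.
have XE : X @^-1` [set u] = \bigcap_(k in [set` [set: 'I_T + 'I_T + unit]%SET]) E k.
  apply/seteqP; split => w /=.
    by move=> Xw [[t|t]|[]] _ /=; rewrite -Xw /= ?tnth_mktuple.
  move=> Ew; have EwT k : E k w by apply: Ew; rewrite /= inE.
  rewrite /X [u]surjective_pairing -(EwT (inr tt)); congr (_, _).
  apply: eq_from_tnth => t; rewrite tnth_mktuple [tnth u.1 t]surjective_pairing.
  by rewrite -(EwT (inl (inl t))) -(EwT (inl (inr t))).
pose r (k : 'I_T + 'I_T + unit) : R :=
  match k with inl _ => n%:R^-1 | inr _ => T%:R^-1 end.
have PE k : P (E k) = (r k)%:E.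
  case: k => [[t|t]|[]] /=.
  - by rewrite (ui t).2 card_ord.
  - by rewrite (uj t).2 card_ord.
  - by rewrite ua.2 card_ord.
split; rewrite XE.
  apply: fin_bigcap_measurable => // k _.
  by case: k => [[t|t]|[]] /=; [exact: (ui t).1|exact: (uj t).1|exact: ua.1].
rewrite ind; last by move=> [[t|t]|[]] _ /=; eexists.
rewrite (eq_bigr (fun k => (r k)%:E)) => [|k _]; last exact: PE.
rewrite prodEFin; congr (_%:E).
rewrite (eq_bigl xpredT) => [|k]; last by rewrite inE.
rewrite !big_sumType /= !prodr_const !card_ord card_unit expr1.
by rewrite -exprMn -expr2 !exprVn.
Qed.

End Expectation.

(** * Numerical conditions for the chosen constants, with [n = q^3] *)

Section StepSize.
Context {R : realType}.
Variables L q : R.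
Hypothesis L_gt0 : 0 < L.
Hypothesis q_ge1 : 1 <= q.

Let eta := (3 * L * q ^+ 2)^-1.
Let beta := L / q.
Let c := L / (10 * q).

Let q_gt0 : 0 < q. Proof. exact: lt_le_trans q_ge1. Qed.
Let q_neq0 : q != 0. Proof. by rewrite gt_eqF. Qed.
Let L_neq0 : L != 0. Proof. by rewrite gt_eqF. Qed.

(** Since [eta beta = 1/(3n)], Young's inequality costs only a third of the contraction [1/n]; to
    leading order [L/(15 q^4)] remains, against a variance term [L/(18 q^4)]. *)
Lemma lyapunov_constant_ineq :
  L ^+ 3 * eta ^+ 2 / 2 + c * (eta * L) ^+ 2 + c * (1 - (q ^+ 3)^-1) * (1 + eta * beta)
    <= c.
Proof.
rewrite -subr_ge0.
have -> : c - (L ^+ 3 * eta ^+ 2 / 2 + c * (eta * L) ^+ 2 +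
    c * (1 - (q ^+ 3)^-1) * (1 + eta * beta)) =
    L * (q ^+ 2 * (q - 1) + 3) / (90 * q ^+ 7).
  by rewrite /c /beta /eta; field; rewrite q_neq0 L_neq0.
rewrite divr_ge0 ?mulr_ge0 ?exprn_ge0 ?(ltW L_gt0) ?(ltW q_gt0)// addr_ge0//.
by rewrite mulr_ge0 ?sqr_ge0 ?subr_ge0.
Qed.

(** As [L eta <= 1/3], [c eta <= 1/30] and [c / beta = 1/10], the terms on the left are at most
    [eta/6], [eta/30] and [eta/10]. *)
Lemma gradient_coefficient_ineq :
  L * eta ^+ 2 / 2 + c * eta ^+ 2 + c * (1 - (q ^+ 3)^-1) * (eta / beta) <= eta / 2.
Proof.
rewrite -subr_ge0.
have -> : eta / 2 - (L * eta ^+ 2 / 2 + c * eta ^+ 2 +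
    c * (1 - (q ^+ 3)^-1) * (eta / beta)) =
    eta * (12 * q ^+ 3 - 5 * q + 2) / (30 * q ^+ 3).
  by rewrite /c /beta /eta; field; rewrite q_neq0 L_neq0.
have eta_ge0 : 0 <= eta.
  by rewrite invr_ge0 !mulr_ge0 ?(ltW q_gt0) ?(ltW L_gt0).
have q3 : q <= q ^+ 3 by rewrite -[leLHS]expr1 ler_weXn2l.
by have q1 := q_ge1; apply: divr_ge0; [apply: (mulr_ge0 eta_ge0)|]; lra.
Qed.

End StepSize.

(** * Expected squared gradient at the output, and the complexity bound *)

Lemma expected_gradient_saga {R : realType} {n d T : nat} (L q fmin : R)
    (f : 'I_n -> 'rV[R]_d -> R) (x0 : 'rV[R]_d)
    {dis : measure_display} {Omega : measurableType dis} (P : probability Omega R)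
    (i j : 'I_T -> Omega -> 'I_n) (a : Omega -> 'I_T) :
  (0 < n)%N -> (0 < T)%N -> 0 < L -> 0 <= q -> q ^+ 3 = n%:R ->
  (forall k, smooth L (f k)) -> (forall x, fmin <= finite_mean f x) ->
  saga_randomness P i j a ->
  ('E_P[fun w => (enorm (gradient (finite_mean f)
      (result f (saga x0 (3 * L * q ^+ 2)^-1
        (fun t => i t w) (fun t => j t w) (a w)))) ^+ 2)%R]
    <= (6 * L * q ^+ 2 * (finite_mean f x0 - fmin) / T%:R)%:E)%E.
Proof.
move=> n_gt0 T_gt0 L_gt0 q_ge0 q3 fL fmin_le rnd; set eta := (3 * L * q ^+ 2)^-1.
have q_ge1 : 1 <= q.
  by rewrite -(@ler_pXn2r _ 3) ?nnegrE// expr1n q3 ler1n.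
have q_gt0 : 0 < q by apply: lt_le_trans q_ge1.
have eta_gt0 : 0 < eta by rewrite invr_gt0 !mulr_gt0 ?exprn_gt0.
(* All random choices are packed into one variable with finitely many equiprobable values. *)
pose X w := ([tuple (i t w, j t w) | t < T], a w).
pose out (u : T.-tuple ('I_n * 'I_n) * 'I_T) :=
  result f (saga x0 eta (fun t => (tnth u.1 t).1) (fun t => (tnth u.1 t).2) u.2).
pose g x := dot (gradient (finite_mean f) x) (gradient (finite_mean f) x).
have -> : (fun w => enorm (gradient (finite_mean f)
      (result f (saga x0 eta (fun t => i t w) (fun t => j t w) (a w)))) ^+ 2) =
    (fun w => g (out (X w))).
  apply/funext => w; rewrite enorm_sqr /out /=.
  have -> : (fun t => (tnth [tuple (i t w, j t w) | t < T] t).1) = (fun t => i t w).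
    by apply/funext => t; rewrite tnth_mktuple.
  have -> : (fun t => (tnth [tuple (i t w, j t w) | t < T] t).2) = (fun t => j t w).
    by apply/funext => t; rewrite tnth_mktuple.
  by [].
have choices u := probability_choices P n T i j a u rnd.
rewrite (expectation_equiprobable P _ X (fun u => g (out u)) _ _ _ (fun u => (choices u).2));
  first last.
- by move=> u; exact: (choices u).1.
- by move=> u; exact: dotvv_ge0.
have c_ge0 : 0 <= L / (10 * q) by rewrite divr_ge0 ?mulr_ge0 ?ltW.
have step s : consistent f s ->
    \sum_i \sum_j lyapunov f (L / (10 * q)) (next_state f eta s i j)
      + n%:R ^+ 2 * (eta / 2 * g (iterate s))
    <= n%:R ^+ 2 * lyapunov f (L / (10 * q)) s.
  move=> cs; apply: (lyapunov_step f eta n_gt0 L L_gt0 fL (L / q)) => //.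
  - by rewrite divr_gt0.
  - by rewrite -q3; exact: lyapunov_constant_ineq.
  - by rewrite -q3; exact: gradient_coefficient_ineq.
have := sum_gap_saga f eta (L / (10 * q)) (fun x => eta / 2 * g x) fmin c_ge0 fmin_le step T x0.
rewrite -mulr_sumr -/(out _) lee_fin; set S := \sum_u _; set D := _ - fmin => SD.
have M_gt0 : 0 < (n%:R ^+ 2) ^+ T :> R by rewrite !exprn_gt0 ?ltr0n.
move: M_gt0 SD; set M := _ ^+ T => M_gt0 SD.
have Tr : 0 < T%:R :> R by rewrite ltr0n.
rewrite ler_pdivlMr//.
have -> : M^-1 / T%:R * S * T%:R = M^-1 * S by field; rewrite !gt_eqF.
(* The constant in the bound is [2 / eta = 6 L q^2]. *)
rewrite ler_pdivrMl// -(ler_pM2l (divr_gt0 eta_gt0 (ltr0n R 2)))//.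
apply: (le_trans SD); rewrite le_eqVlt; apply/orP; left; apply/eqP.
by rewrite /eta; field; rewrite !gt_eqF.
Qed.

Theorem corollary1 (R : realType) (L Delta : R) (L_gt0 : 0 < L) :
  exists2 C : R, 0 < C &
  forall (n d : nat) (f : 'I_n -> 'rV[R]_d -> R) (x0 xstar : 'rV[R]_d),
    (0 < n)%N ->
    (forall i, smooth L (f i)) ->
    (forall x, finite_mean f xstar <= finite_mean f x) ->
    finite_mean f x0 - finite_mean f xstar = Delta ->
  let eta := (3 * L * n%:R `^ (2 / 3))^-1 in
  forall eps : R, 0 < eps ->
  exists T : nat, [/\ (0 < T)%N,
    (forall (dis : measure_display) (Omega : measurableType dis)
        (P : probability Omega R)
        (i j : 'I_T -> Omega -> 'I_n) (a : Omega -> 'I_T),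
      saga_randomness P i j a ->
      let x_a (w : Omega) : 'rV[R]_d :=
        result f (saga x0 eta (fun t => i t w) (fun t => j t w) (a w)) in
      ('E_P[fun w => (enorm (gradient (finite_mean f) (x_a w)) ^+ 2)%R]
        <= eps%:E)%E)
    & (forall (i j : 'I_T -> 'I_n) (a : 'I_T),
      (ifo_calls f (saga x0 eta i j a))%:R
        <= C * (n%:R + n%:R `^ (2 / 3) / eps)) ].
Proof.
have LD_ge0 : 0 <= L * `|Delta| by rewrite mulr_ge0 ?normr_ge0 ?(ltW L_gt0).
(* With [T <= K + 1] for the [K] below, [n + 2 T <= n + 2 + 2 K]; here [2 <= 2 n] and [2 K] is
   [12 L |Delta|] times [q^2 / eps]. The absolute value makes the constant positive before any [f]
   is given. *)
exists (3 + 12 * (L * `|Delta|)); first by lra.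
move=> n d f x0 xstar n_gt0 fL min_f fDelta eta eps eps_gt0.
pose q : R := n%:R `^ 3^-1.
have q_ge0 : 0 <= q by exact: powR_ge0.
have q3 : q ^+ 3 = n%:R by rewrite -powR_mulrn// -powRrM mulVf ?powRr1.
have q2 : n%:R `^ (2 / 3) = q ^+ 2.
  by rewrite -powR_mulrn// -powRrM mulrC.
pose K := 6 * (L * `|Delta|) * q ^+ 2 / eps.
have K_ge0 : 0 <= K by rewrite divr_ge0 ?(ltW eps_gt0)// mulr_ge0 ?sqr_ge0// mulr_ge0.
have /andP[TK KT] := truncn_itv K_ge0.
(* The successor makes [T] positive even for [K = 0] and gives [K < T], which yields accuracy
   [eps]. *)
exists (Num.truncn K).+1; split=> // [dis Omega P i j a rnd|i j a].
- rewrite /= /eta q2.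
  apply: le_trans (expected_gradient_saga L q _ f x0 P i j a n_gt0 _ L_gt0 q_ge0
    q3 fL min_f rnd) _ => //.
  rewrite lee_fin fDelta ler_pdivrMr ?ltr0n// [leRHS]mulrC -ler_pdivrMr//.
  apply: le_trans (ltW KT); rewrite /K ler_wpM2r ?invr_ge0 ?(ltW eps_gt0)//.
  have := ler_norm Delta => DD.
  have := ler_wpM2l (mulr_ge0 (ltW L_gt0) (sqr_ge0 q)) DD; lra.
- rewrite ifo_calls_saga q2 natrD -muln2 natrM -natr1.
  have n1 : 1 <= n%:R :> R by rewrite ler1n.
  have e : 0 <= q ^+ 2 / eps by rewrite divr_ge0 ?sqr_ge0 ?(ltW eps_gt0).
  have := mulr_ge0 LD_ge0 (ler0n R n) => LDn.
  have KE : K = 6 * (L * `|Delta|) * (q ^+ 2 / eps) by rewrite [RHS]mulrA.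
  by move: TK; rewrite [leRHS]KE; lra.
Qed.
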